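(* Let $\mathcal{V}$ be a vector space over a field $\mathbb{F}$, let $L=\{0,1,\ldots,\ell\}$, and let $P=P_0P_1\cdots P_\ell:\mathcal{V}\to\mathcal{V}$ be an $\alpha$-decomposition, $\emptyset\ne\alpha\subseteq2^L$, with associated operators $Q_J$, $J\in\alpha$. Then $$\mathcal{R}(P)=\bigcap_{J\in\alpha}\mathcal{R}(P_J),\qquad\mathcal{N}(P)=\sum_{J\in\alpha}\mathcal{N}(P_J)$$ (the latter a not necessarily direct sum of subspaces). If $\alpha$ consists of mutually disjoint sets then $$\mathcal{N}(P)=\bigoplus_{J\in\alpha}\mathcal{N}(P_J),$$ and this is given by $$\mathrm{id}_{\mathcal{N}(P)}=\sum_{J\in\alpha}\operatorname{Proj}_J,$$ where, for each $I\in\alpha$, $\operatorname{Proj}_I:\mathcal{N}(P)\to\mathcal{N}(P_I)$ is the projection given by the restriction of $Q_IP^I$.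
   Context: $\mathcal{R}(A)$ and $\mathcal{N}(A)$ denote the image and kernel of a linear operator $A$. For $J\subseteq L$ write $P_J:=\prod_{j\in J}P_j$ (with $P_\emptyset:=\mathrm{id}_{\mathcal{V}}$) and $P^J:=P_{L\setminus J}$. Definition ($\alpha$-decomposition): let $\emptyset\ne\alpha\subseteq2^L$ with $L\notin\alpha$. An expression $P=P_0P_1\cdots P_\ell$ as a composition of linear operators $P_i:\mathcal{V}\to\mathcal{V}$ is an $\alpha$-decomposition of $P$ if there exist linear operators $Q_J:\mathcal{V}\to\mathcal{V}$, $J\in\alpha$, such that $$\mathrm{id}_{\mathcal{V}}=\sum_{J\in\alpha}Q_JP^J,$$ and $P_iP_j=P_jP_i$, $P_iQ_J=Q_JP_i$ for all $i,j\in L$, $J\in\alpha$. *)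

(* Defs.v *)
From HB Require Import structures.
From mathcomp Require Import all_boot all_order all_algebra.
From mathcomp Require Import classical_sets.

Set Implicit Arguments.
Unset Strict Implicit.
Unset Printing Implicit Defensive.

Import GRing.Theory.

Local Open Scope classical_set_scope.
Local Open Scope ring_scope.

Section Subspaces.
Variables (F : fieldType) (V : lmodType F).

(* Vectors live in a possibly infinite-dimensional [V], so subspaces are
   represented by classical sets rather than by {vspace _}. *)
Definition kernel (f : V -> V) : set V := [set x | f x = 0].

Definition sum_of_subspaces (T : finType) (A : {set T}) (W : T -> set V) :
    set V :=
  [set x | exists2 u : T -> V,
     (forall J, J \in A -> W J (u J)) & x = \sum_(J in A) u J].

(* Values of [u] and [v] outside [A] are irrelevant. *)
Definition independent_subspaces (T : finType) (A : {set T})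
    (W : T -> set V) : Prop :=
  forall u v : T -> V,
    (forall J, J \in A -> W J (u J)) -> (forall J, J \in A -> W J (v J)) ->
    \sum_(J in A) u J = \sum_(J in A) v J -> forall J, J \in A -> u J = v J.

Definition is_direct_sum (U : set V) (T : finType) (A : {set T})
    (W : T -> set V) : Prop :=
  U = sum_of_subspaces A W /\ independent_subspaces A W.

(* [f], restricted to the (direct) sum of the [W J], is the projection onto
   the summand [W I] along the other summands. *)
Definition is_summand_projection (T : finType) (A : {set T})
    (W : T -> set V) (I : T) (f : V -> V) : Prop :=
  forall u : T -> V, (forall J, J \in A -> W J (u J)) ->
    f (\sum_(J in A) u J) = u I.

End Subspaces.

Section AlphaDecomposition.
Variables (F : fieldType) (V : lmodType F) (l : nat).

(* [P_J]; the factors are composed in increasing order of the indices. *)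
Definition subprod (Ps : 'I_l.+1 -> {linear V -> V}) (J : {set 'I_l.+1}) :
    V -> V :=
  \big[@comp V V V/idfun]_(j in J) (Ps j : V -> V).

(* [P^J], the product over the complement of [J]. *)
Definition cosubprod (Ps : 'I_l.+1 -> {linear V -> V}) (J : {set 'I_l.+1}) :
    V -> V :=
  subprod Ps (~: J)%SET.

(* [Q J] is only meaningful for [J \in alpha]. *)
Record alpha_decomposition (alpha : {set {set 'I_l.+1}})
    (P : {linear V -> V}) (Ps : 'I_l.+1 -> {linear V -> V})
    (Q : {set 'I_l.+1} -> {linear V -> V}) : Prop := {
  alpha_neq0 : alpha != finset.set0;
  alpha_proper : finset.setT \notin alpha;
  alpha_factor : P =1 \big[@comp V V V/idfun]_(i < l.+1) (Ps i : V -> V);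
  alpha_id : forall x : V, x = \sum_(J in alpha) Q J (cosubprod Ps J x);
  alpha_commPP : forall i j, Ps i \o Ps j =1 Ps j \o Ps i;
  alpha_commPQ : forall i J, J \in alpha -> Ps i \o Q J =1 Q J \o Ps i
}.

End AlphaDecomposition.

(* Main.v *)
Require Import Defs.
From HB Require Import structures.
From mathcomp Require Import all_boot all_order all_algebra.
From mathcomp Require Import classical_sets functions boolp.

Set Implicit Arguments.
Unset Strict Implicit.
Unset Printing Implicit Defensive.

Import GRing.Theory.

Local Open Scope classical_set_scope.
Local Open Scope ring_scope.

(** Because the factors commute with one another and with the [Q J], for each
    [J] the operator [P] is [P_J P^J = P^J P_J], and everything follows from
    letting the identity [x = \sum_J Q_J P^J x] act on a suitable vector.
    - Range: if [x = P_J y_J] for every [J] in [alpha], the identity becomes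
      [x = \sum_J Q_J P^J P_J y_J = P (\sum_J Q_J y_J)].
    - Kernel: if [P x = 0], the [J]-th term of the identity is killed by [P_J],
      since [P_J Q_J P^J x = Q_J P x].
    - Disjoint case: if [I] and [J] are disjoint then [J] lies in the complement
      of [I], so [P_J] is a factor of [P^I] and [P^I] vanishes on the kernel of
      [P_J].  Hence [Q_I P^I] kills the kernel of [P_J] for [J != I], and on the
      kernel of [P_I] the identity collapses to [x = Q_I P^I x]: the operators
      [Q_I P^I] are the projections onto the summands, whose existence forces
      the sum to be direct. *)

Section Subprod.
Variables (F : fieldType) (V : lmodType F) (l : nat).
Variable Ps : 'I_l.+1 -> {linear V -> V}.
Implicit Types (I J K : {set 'I_l.+1}).

Fact subprod_is_linear J : linear (subprod Ps J).
Proof.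
rewrite /subprod; apply: big_ind => // [f g flin glin | i _] a x y /=.
  by rewrite glin flin.
exact: linearP.
Qed.

HB.instance Definition _ J :=
  GRing.isLinear.Build F V V *:%R (subprod Ps J) (subprod_is_linear J).

Lemma comm_subprod (g : V -> V) J :
  (forall i, Ps i \o g =1 g \o Ps i) -> subprod Ps J \o g =1 g \o subprod Ps J.
Proof.
move=> gC; rewrite /subprod.
apply: (big_ind (fun f : V -> V => f \o g =1 g \o f)) => // f h fC hC x.
exact: etrans (congr1 f (hC x)) (fC (h x)).
Qed.

Hypothesis PsC : forall i j, Ps i \o Ps j =1 Ps j \o Ps i.

Lemma subprodC J K :
  subprod Ps J \o subprod Ps K =1 subprod Ps K \o subprod Ps J.
Proof.
apply: comm_subprod => i x; apply/esym.
by apply: (comm_subprod (g := Ps i)) => j; apply: PsC.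
Qed.

(** The factors of [subprod] come in increasing order of the indices, so
    separating those in [J] from those in [K] takes commutation; composition is
    no commutative monoid law, and the general reindexing lemmas for iterated
    operators do not apply. *)
Lemma subprodU J K : (J :&: K)%SET = finset.set0 ->
  subprod Ps (J :|: K)%SET =1 subprod Ps J \o subprod Ps K.
Proof.
move=> JK0; rewrite /subprod.
elim: (index_enum _) => [|i s IHs] x; first by rewrite !big_nil.
have PsiC (A : {set 'I_l.+1}) y :
    (\big[comp/idfun]_(j <- s | j \in A) (Ps j : V -> V)) (Ps i y)
    = Ps i ((\big[comp/idfun]_(j <- s | j \in A) (Ps j : V -> V)) y).
  elim/big_ind: _ y => // [f g fC gC y | j _ y] /=; first by rewrite gC fC.
  exact: PsC.
rewrite !big_cons finset.in_setU; case iJ: (i \in J); case iK: (i \in K) => /=.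
- by have := finset.in_set0 i; rewrite -JK0 finset.in_setI iJ iK.
- by rewrite IHs.
- by rewrite IHs /= PsiC.
- exact: IHs.
Qed.

Lemma subprod_cosubprod J x :
  (\big[comp/idfun]_(i < l.+1) (Ps i : V -> V)) x
  = subprod Ps J (cosubprod Ps J x).
Proof.
rewrite -[RHS]subprodU; last exact: finset.setICr.
rewrite finset.setUCr /subprod.
by under [in RHS]eq_bigl do rewrite finset.in_setT.
Qed.

(** If [J] is disjoint from [I], then [P_J] is one of the factors of [P^I]. *)
Lemma cosubprod_kernel I J x :
  (I :&: J)%SET = finset.set0 -> kernel (subprod Ps J) x ->
  cosubprod Ps I x = 0.
Proof.
move=> IJ0 xJ0; rewrite /cosubprod -(finset.setID (~: I)%SET J) finset.setUC.
have -> : (~: I :&: J)%SET = J.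
  apply/finset.setIidPr.
  by rewrite -finset.setD_eq0 finset.setDE finset.setCK finset.setIC IJ0.
rewrite subprodU; last first.
  by rewrite finset.setIC finset.setIDA finset.setDIl finset.setDv finset.set0I.
by rewrite /= xJ0 linear0.
Qed.

End Subprod.

Section AlphaDecompositionTheory.
Variables (F : fieldType) (V : lmodType F) (l : nat).
Variables (alpha : {set {set 'I_l.+1}}) (P : {linear V -> V}).
Variables (Ps : 'I_l.+1 -> {linear V -> V}).
Variable Q : {set 'I_l.+1} -> {linear V -> V}.
Hypothesis decP : alpha_decomposition alpha P Ps Q.
Implicit Types (I J : {set 'I_l.+1}).

Let PsC := alpha_commPP decP.

Lemma alpha_subprodl J x : P x = subprod Ps J (cosubprod Ps J x).
Proof. by rewrite (alpha_factor decP) (subprod_cosubprod PsC J). Qed.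

Lemma alpha_subprodr J x : P x = cosubprod Ps J (subprod Ps J x).
Proof. by rewrite (alpha_subprodl J); apply: (subprodC PsC). Qed.

Lemma subprodQ I J x : J \in alpha ->
  subprod Ps I (Q J x) = Q J (subprod Ps I x).
Proof.
move=> Ja; apply: (comm_subprod (g := Q J)) => i.
exact: (alpha_commPQ decP).
Qed.

Lemma alpha_PQ J x : J \in alpha -> P (Q J x) = Q J (P x).
Proof.
by move=> Ja; rewrite !(alpha_subprodl finset.set0) /cosubprod !subprodQ.
Qed.

Lemma range_alpha :
  range P = \bigcap_(J in [set` alpha]) range (subprod Ps J).
Proof.
apply/seteqP; split=> [_ [x _ <-] J _ | x xR].
  by exists (cosubprod Ps J x); rewrite // -alpha_subprodl.
(* Unlike the range condition, which only constrains [J \in alpha], the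
   choice function must be total. *)
have /choice[y yE] J : exists y, J \in alpha -> subprod Ps J y = x.
  case: (boolP (J \in alpha)) => [Ja|_]; last by exists 0.
  by have [y _ yx] := xR J Ja; exists y.
exists (\sum_(J in alpha) Q J (y J)) => //.
rewrite linear_sum [RHS](alpha_id decP); apply: eq_bigr => J Ja.
by rewrite alpha_PQ // (alpha_subprodr J) yE.
Qed.

Lemma alpha_summand_kernel J x : J \in alpha -> kernel P x ->
  kernel (subprod Ps J) (Q J (cosubprod Ps J x)).
Proof.
by move=> Ja Px0; rewrite /kernel /= subprodQ // -alpha_subprodl Px0 linear0.
Qed.

Lemma kernel_alpha :
  kernel P = sum_of_subspaces alpha (fun J => kernel (subprod Ps J)).
Proof.
apply/seteqP; split=> [x Px0 | _ [u uK ->]].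
  exists (fun J => Q J (cosubprod Ps J x)); last exact: (alpha_id decP).
  by move=> J Ja; apply: alpha_summand_kernel.
rewrite /kernel /= linear_sum big1 // => J Ja.
by rewrite (alpha_subprodr J) (uK J Ja) /cosubprod linear0.
Qed.

Hypothesis alpha_disjoint : forall I J, I \in alpha -> J \in alpha -> I != J ->
  (I :&: J)%SET = finset.set0.

Lemma alpha_proj_id I x : I \in alpha -> kernel (subprod Ps I) x ->
  Q I (cosubprod Ps I x) = x.
Proof.
move=> Ia xI0; rewrite [RHS](alpha_id decP) (bigD1 I) //= big1 ?addr0 //.
move=> J /andP[Ja JI].
by rewrite (cosubprod_kernel PsC (alpha_disjoint Ja Ia JI) xI0) linear0.
Qed.

Lemma alpha_is_projection I : I \in alpha ->
  is_summand_projection alpha (fun J => kernel (subprod Ps J)) I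
    (Q I \o cosubprod Ps I).
Proof.
move=> Ia u uK; rewrite /= (bigD1 I) //= /cosubprod linearD linear_sum /=.
rewrite [X in _ + X]big1 ?addr0; first exact: alpha_proj_id (uK I Ia).
move=> J /andP[Ja JI]; apply: (cosubprod_kernel PsC) (uK J Ja).
by apply: alpha_disjoint; rewrite // eq_sym.
Qed.

End AlphaDecompositionTheory.

(** An equation between two sums, mapped by the [J]-th projection, becomes the
    equality of their [J]-th components. *)
Lemma independent_of_projections (F : fieldType) (V : lmodType F) (T : finType)
    (A : {set T}) (W : T -> set V) (f : T -> V -> V) :
  (forall J, J \in A -> is_summand_projection A W J (f J)) ->
  independent_subspaces A W.
Proof. by move=> fP u v uW vW uv J JA; rewrite -(fP J JA u uW) uv fP. Qed.

Theorem corollary2p11 (F : fieldType) (V : lmodType F) (l : nat)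
    (alpha : {set {set 'I_l.+1}}) (P : {linear V -> V})
    (Ps : 'I_l.+1 -> {linear V -> V})
    (Q : {set 'I_l.+1} -> {linear V -> V})
    (decP : alpha_decomposition alpha P Ps Q) :
  [/\ range P = \bigcap_(J in [set` alpha]) range (subprod Ps J),
      kernel P = sum_of_subspaces alpha (fun J => kernel (subprod Ps J)) &
      (forall I J, I \in alpha -> J \in alpha -> I != J ->
         (I :&: J)%SET = finset.set0) ->
      [/\ is_direct_sum (kernel P) alpha (fun J => kernel (subprod Ps J)),
          (forall x, kernel P x ->
             x = \sum_(J in alpha) (Q J \o cosubprod Ps J) x) &
          forall I, I \in alpha ->
            set_fun (kernel P) (kernel (subprod Ps I))
              (Q I \o cosubprod Ps I) /\
            is_summand_projection alpha (fun J => kernel (subprod Ps J)) I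
              (Q I \o cosubprod Ps I)]].
Proof.
split; [exact: range_alpha decP | exact: kernel_alpha decP | move=> dis; split].
- split; first exact: kernel_alpha decP.
  apply: independent_of_projections => J Ja.
  exact: (alpha_is_projection decP).
- by move=> x _; exact: (alpha_id decP x).
- move=> I Ia; split; last exact: (alpha_is_projection decP).
  by move=> x; exact: (alpha_summand_kernel decP Ia).
Qed.
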